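(* Let $\mathcal F=\{\boldsymbol f_1,\dots,\boldsymbol f_n\}\subset\mathbb R^k$ be a unit $(n,k)$ equiangular tight frame of angle $c\in(0,1)$, and write $c=1/\alpha$. Then the following are equivalent: (i) $\alpha$ is a positive integer; (ii) $\Lambda(\mathcal F)$ is a lattice; (iii) $Q_{\mathcal F}$ has separated values. Moreover, if $\alpha$ is a positive integer, then the minimal norm $|\Lambda(\mathcal F)|:=\min\{\|\boldsymbol x\|:\boldsymbol 0\ne\boldsymbol x\in\Lambda(\mathcal F)\}$ satisfies $|\Lambda(\mathcal F)|\ge \frac{1}{\sqrt{\alpha}}$.
   Context: $\langle\cdot,\cdot\rangle$ is the usual inner product on $\mathbb R^k$ and $\|\cdot\|$ the Euclidean norm. A set $\mathcal F=\{\boldsymbol f_1,\dots,\boldsymbol f_n\}\subset\mathbb R^k$ is an $(n,k)$ tight frame if $n>k$, $\operatorname{span}_{\mathbb R}\{\boldsymbol f_1,\dots,\boldsymbol f_n\}=\mathbb R^k$, and there is a real $\gamma>0$ such that $\|\boldsymbol x\|^2=\gamma\sum_{i=1}^n\langle\boldsymbol f_i,\boldsymbol x\rangle^2$ for every $\boldsymbol x\in\mathbb R^k$. A unit $(n,k)$ equiangular tight frame (ETF) of angle $c\in(0,1)$ is an $(n,k)$ tight frame consisting of unit vectors such that $|\langle\boldsymbol f_i,\boldsymbol f_j\rangle|=c$ for all $1\le i\ne j\le n$. Let $G$ be the $k\times n$ matrix with columns $\boldsymbol f_1,\dots,\boldsymbol f_n$. Put $\Lambda(\mathcal F)=\operatorname{span}_{\mathbb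 Z}\{\boldsymbol f_1,\dots,\boldsymbol f_n\}=\{G\boldsymbol a:\boldsymbol a\in\mathbb Z^n\}$. A lattice is a discrete additive subgroup of $\mathbb R^k$. The norm-form of $\mathcal F$ is the quadratic form $Q_{\mathcal F}(\boldsymbol a)=\|G\boldsymbol a\|^2=\langle G^\top G\boldsymbol a,\boldsymbol a\rangle$. A quadratic form $Q(\boldsymbol a)=\langle H\boldsymbol a,\boldsymbol a\rangle$ on $\mathbb R^n$, with $H$ a real symmetric $n\times n$ matrix, has separated values if $\inf\{|Q(\boldsymbol a)-Q(\boldsymbol b)|:\boldsymbol a,\boldsymbol b\in\mathbb Z^n,\ Q(\boldsymbol a)\ne Q(\boldsymbol b)\}>0$. *)

(* Defs.v *)
From HB Require Import structures.
From mathcomp Require Import all_boot all_order all_algebra.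
From mathcomp Require Import all_classical all_reals all_analysis.
Set Implicit Arguments.
Unset Strict Implicit.
Unset Printing Implicit Defensive.
Import Order.TTheory GRing.Theory Num.Theory.
Import numFieldNormedType.Exports.
Local Open Scope classical_set_scope.
Local Open Scope ring_scope.

Definition inner (R : realType) (k : nat) (x y : 'cV[R]_k) : R :=
  \sum_i x i 0 * y i 0.

(* The library norm `|x| on matrices is the sup norm. *)
Definition enorm (R : realType) (k : nat) (x : 'cV[R]_k) : R :=
  Num.sqrt (inner x x).

Definition is_tight_frame (R : realType) (n k : nat) (f : 'I_n -> 'cV[R]_k) :=
  [/\ (k < n)%N,
      (<<codom f>> = fullv)%VS
    & exists2 gamma : R, 0 < gamma &
        forall x, enorm x ^+ 2 = gamma * \sum_i inner (f i) x ^+ 2].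

Definition is_unit_etf (R : realType) (n k : nat) (f : 'I_n -> 'cV[R]_k)
    (c : R) :=
  [/\ 0 < c < 1,
      is_tight_frame f,
      forall i, enorm (f i) = 1
    & forall i j, i != j -> `|inner (f i) (f j)| = c].

Definition frame_mx (R : realType) (n k : nat) (f : 'I_n -> 'cV[R]_k) :
  'M[R]_(k, n) := \matrix_(i, j) f j i 0.

Definition int_vec (R : realType) (n : nat) (a : 'cV[int]_n) : 'cV[R]_n :=
  map_mx intr a.

Definition int_span (R : realType) (n k : nat) (f : 'I_n -> 'cV[R]_k) :
  set 'cV[R]_k := range (fun a : 'cV[int]_n => frame_mx f *m int_vec R a).

(* [isolated] refers to the product topology on 'cV[R]_k, which is the usual
   topology of R^k. *)
Definition is_lattice (R : realType) (k : nat) (L : set 'cV[R]_k) :=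
  zmod_closed (mem L) /\ L `<=` isolated L.

Definition norm_form (R : realType) (n k : nat) (f : 'I_n -> 'cV[R]_k)
    (a : 'cV[R]_n) : R := enorm (frame_mx f *m a) ^+ 2.

Definition quad_form (R : realType) (n : nat) (H : 'M[R]_n) (a : 'cV[R]_n) : R :=
  inner (H *m a) a.

(* The infimum is taken in \bar R, so that it is +oo (hence positive) when Q is
   constant on Z^n. *)
Definition separated_values (R : realType) (n : nat) (Q : 'cV[R]_n -> R) :=
  (0 < ereal_inf [set r : \bar R | exists a b : 'cV[int]_n,
         Q (int_vec R a) != Q (int_vec R b) /\
         r = `|Q (int_vec R a) - Q (int_vec R b)|%:E])%E.

Definition is_minimal_norm (R : realType) (k : nat) (L : set 'cV[R]_k) (m : R) :=
  let norms := [set enorm x | x in L `\ 0] in norms m /\ lbound norms m.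

Lemma inner_mx (R : realType) (k : nat) (x y : 'cV[R]_k) :
  inner x y = (x^T *m y) 0 0.
Proof. by rewrite mxE; apply: eq_bigr => i _; rewrite mxE. Qed.

Lemma enorm_sqr (R : realType) (k : nat) (x : 'cV[R]_k) :
  enorm x ^+ 2 = inner x x.
Proof.
rewrite sqr_sqrtr //; apply: sumr_ge0 => i _; rewrite -expr2; exact: sqr_ge0.
Qed.

Lemma gram_sym (R : realType) (n k : nat) (f : 'I_n -> 'cV[R]_k) :
  ((frame_mx f)^T *m frame_mx f)^T = (frame_mx f)^T *m frame_mx f.
Proof. by rewrite trmx_mul trmxK. Qed.

Lemma norm_form_quad (R : realType) (n k : nat) (f : 'I_n -> 'cV[R]_k) :
  norm_form f = quad_form ((frame_mx f)^T *m frame_mx f).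
Proof.
apply/funext => a; rewrite /norm_form /quad_form enorm_sqr !inner_mx.
by rewrite !trmx_mul trmxK !mulmxA.
Qed.

(* So the family f really enumerates a set of n vectors. *)
Lemma unit_etf_inj (R : realType) (n k : nat) (f : 'I_n -> 'cV[R]_k) (c : R) :
  is_unit_etf f c -> injective f.
Proof.
case=> /andP[_ c1] _ u e i j fij; apply/eqP/negPn/negP => /e.
by rewrite -fij -enorm_sqr u expr1n normr1 => c1E; rewrite -c1E ltxx in c1.
Qed.

(* Main.v *)
Require Import Defs.
From HB Require Import structures.
From mathcomp Require Import all_boot all_order all_algebra.
From mathcomp Require Import all_classical all_reals all_analysis.
From mathcomp Require Import lra.
Import Order.TTheory GRing.Theory Num.Theory.
Import numFieldNormedType.Exports.
Local Open Scope classical_set_scope.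
Local Open Scope ring_scope.

(** Let [G] be the frame matrix.  Since [f] is equiangular, its Gram matrix is
    [G^T G = 1 + c S] with [S] an integer matrix (the Seidel matrix, with
    entries 0 on the diagonal and +1 or -1 elsewhere), so
    [alpha G^T G = alpha + S].

    If [alpha] is an integer, [alpha *: G^T G] is an integer matrix and
    [alpha ||G a||^2] is an integer for every integral [a]
    ([norm_form_int]).  Hence the values of the norm-form are multiples of
    [1 / alpha], nonzero elements of the integral span have squared norm at
    least [1 / alpha], and the least of these norms is attained because the
    numbers [alpha ||G a||^2] are naturals.

    Conversely, separation of values, applied to [G a] and [G 0 = 0], bounds
    the norms of the nonzero elements from below ([separated_norm_ge]), which
    makes the integral span a lattice ([lattice_of_norm_ge]); so it suffices
    to deduce from discreteness that [alpha] is an integer.  As there are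
    more vectors than dimensions, the pigeonhole principle yields a nonzero
    integral [a] with [G a] as small as one likes
    ([small_integer_combination]), so in a lattice [G a = 0] for some integral
    [a != 0].  Then [(1 + c S) a = 0], that is, [- S a = alpha a]: the integer
    matrix [- S] has the eigenvalue [alpha] with an integral eigenvector, and
    this forces [alpha] to be an integer ([int_eigenvector_int]). *)

(** * Integral vectors *)

Lemma int_vecB {R : realType} {n : nat} (a b : 'cV[int]_n) :
  int_vec R (a - b) = int_vec R a - int_vec R b.
Proof. exact: map_mxB. Qed.

(** Dirichlet's box principle.  The [N ^ n] integral vectors with entries in
    [0, N) are mapped by [G] into a cube of side proportional to [N], which is
    covered by about [(K N) ^ k] cells of side [delta], with [K] independent of
    [N].  Since [k < n], two of them share a cell as soon as [N] is large, and
    their difference is the required combination. *)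
Lemma small_integer_combination {R : realType} {k n : nat} (G : 'M[R]_(k, n))
    {delta : R} : (k < n)%N -> 0 < delta ->
  exists2 a : 'cV[int]_n, a != 0 &
    forall i, `|(G *m int_vec R a) i 0| < delta.
Proof.
move=> kn d0; pose S := \sum_i \sum_j `|G i j|.
pose K := Num.bound (2 * S / delta).
have SK : 2 * S / delta <= K%:R.
  by apply/ltW/archi_boundP; rewrite divr_ge0 ?mulr_ge0 ?sumr_ge0 ?ltW// => i _;
    rewrite sumr_ge0.
(* The number of cells is at most [(K.+1 * N) ^ k], and any [N] above
   [K.+1 ^ k] makes this smaller than [N ^ k.+1 <= N ^ n]. *)
pose N := (K.+1 ^ k).+1.
pose v (a : {ffun 'I_n -> 'I_N}) : 'cV[int]_n := \col_j (a j : nat)%:Z.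
(* The coordinates of the image, shifted to be nonnegative and measured in
   units of [delta], so that a cell is given by integral parts. *)
pose y a i := ((G *m int_vec R (v a)) i 0 + S * N%:R) / delta.
have y_itv a i : 0 <= y a i <= (K * N)%:R.
  have bnd : `|(G *m int_vec R (v a)) i 0| <= S * N%:R.
    rewrite mxE; apply: le_trans (ler_norm_sum _ _ _) _.
    rewrite /S (bigD1 i)//= mulrDl; apply: ler_wpDr.
      by rewrite mulr_ge0// sumr_ge0// => j _; rewrite sumr_ge0.
    rewrite mulr_suml; apply: ler_sum => j _; rewrite normrM ler_wpM2l//.
    by rewrite !mxE/= normr_nat ler_nat ltnW.
  move: bnd; rewrite ler_norml => /andP[l u].
  rewrite divr_ge0 ?(ltW d0)//=; last by lra.
  rewrite natrM; apply: le_trans (ler_wpM2r (ler0n _ N) SK).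
  by rewrite mulrAC ler_pM2r ?invr_gt0//; lra.
pose cell a := [ffun i => inord (Num.truncn (y a i)) : 'I_(K * N).+1].
have /injectivePn[a [b ab cab]] : ~~ injectiveb cell.
  apply/negP => /injectiveP /leq_card; rewrite !card_ffun !card_ord leqNgt.
  case/negP; apply: (@leq_ltn_trans ((K.+1 * N) ^ k)).
    have [->//|k0] := posnP k.
    by rewrite leq_exp2r// mulSn -add1n leq_add2r.
  rewrite expnMn; apply: (@leq_trans (N ^ k.+1)).
    by rewrite expnS ltn_pmul2r ?expn_gt0.
  by rewrite leq_pexp2l.
exists (v a - v b).
  apply: contraNneq ab => /eqP; rewrite subr_eq0 => /eqP/matrixP vab.
  apply/eqP/ffunP => j; have := vab j 0; rewrite !mxE => -[] /eqP.
  by move=> /eqP /val_inj.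
move=> i; rewrite int_vecB mulmxBr mxE [X in _ + X]mxE.
have := congr1 (fun g : {ffun 'I_k -> 'I__} => val (g i)) cab; rewrite !ffunE /=.
have trK c : nat_of_ord (inord (Num.truncn (y c i)) : 'I_(K * N).+1) = Num.truncn (y c i).
  rewrite inordK// ltnS; have /andP[y0 yK] := y_itv c i.
  by rewrite -(ler_nat R); apply: le_trans yK; have /andP[] := truncn_itv y0.
rewrite !trK => tab.
have /andP[ya _] := y_itv a i; have /andP[yb _] := y_itv b i.
have := truncn_itv ya; have := truncn_itv yb; rewrite tab.
set t := Num.truncn _; rewrite -addn1 natrD => /andP[b1 b2] /andP[a1 a2].
have -> : (G *m int_vec R (v a)) i 0 - (G *m int_vec R (v b)) i 0
   = delta * (y a i - y b i).
  by rewrite /y -mulrBl mulrC divfK ?gt_eqF//; lra.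
rewrite normrM (gtr0_norm d0) -[ltRHS]mulr1 ltr_pM2l// ltr_norml.
by apply/andP; split; lra.
Qed.

(** Infinite descent: subtracting the integral part of [lambda] from [S] gives
    an integer matrix whose eigenvalue on [a] is the fractional part [t] of
    [lambda].  So [t *: a] is again an integral eigenvector for [lambda], and
    its entries are strictly smaller than those of [a] unless they vanish.
    A nonzero entry of [a] cannot shrink forever, so [t = 0]. *)
Lemma int_eigenvector_int {R : realType} {n : nat} (S : 'M[int]_n)
    {a : 'cV[int]_n} {lambda : R} :
  a != 0 -> map_mx intr S *m int_vec R a = lambda *: int_vec R a ->
  lambda \is a Num.int.
Proof.
move=> /matrix0Pn[i [j]]; rewrite (ord1 j) {j}.
have [N] := ubnP `|a i 0%R|%N; elim: N a => // N IH a aN ai0 Sa.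
pose m := Num.floor lambda; pose t := lambda - m%:~R.
have /andP[t0 t1] : 0 <= t < 1.
  have := floor_itv lambda; rewrite intrD -/m => /andP[l u].
  by apply/andP; split; rewrite /t; lra.
pose b := S *m a - m *: a.
have bE : int_vec R b = t *: int_vec R a.
  rewrite int_vecB /t scalerBl -Sa; congr (_ - _); first exact: map_mxM.
  by apply/matrixP => p q; rewrite !mxE intrM.
have bi : (b i 0)%:~R = t * (a i 0)%:~R :> R.
  by have /matrixP/(_ i 0) := bE; rewrite !mxE.
have [bi0|bi0] := eqVneq (b i 0) 0.
  move: bi; rewrite bi0 => /esym/eqP; rewrite mulf_eq0 intr_eq0 (negPf ai0) orbF.
  by rewrite subr_eq0 => /eqP ->; exact: intr_int.
apply: (IH b) => //.
  rewrite (leq_trans _ (_ : `|a i 0%R|%N <= N)%N)// -(ltr_nat R).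
  rewrite !natr_absz !intr_norm bi normrM (ger0_norm t0) gtr_pMl//.
  by rewrite normr_gt0 intr_eq0.
by rewrite bE -scalemxAr Sa !scalerA mulrC.
Qed.

(** * Gram matrix and norm-form of an equiangular frame *)

Definition seidel {R : realType} {n k : nat} (f : 'I_n -> 'cV[R]_k) :
    'M[int]_n :=
  \matrix_(i, j) if i == j then 0 else sgz (inner (f i) (f j)).

Lemma inner_frame {R : realType} {n k : nat} (f : 'I_n -> 'cV[R]_k) i j :
  ((frame_mx f)^T *m frame_mx f) i j = inner (f i) (f j).
Proof. by rewrite mxE; apply: eq_bigr => l _; rewrite !mxE. Qed.

Lemma gram_seidel {R : realType} {n k : nat} {f : 'I_n -> 'cV[R]_k} {c : R} :
  is_unit_etf f c ->
  (frame_mx f)^T *m frame_mx f = 1%:M + c *: map_mx intr (seidel f).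
Proof.
case=> _ _ f1 fc; apply/matrixP => i j; rewrite inner_frame !mxE.
have [->|ij] := eqVneq i j; first by rewrite -enorm_sqr f1 mulr0 addr0 expr1n.
by rewrite add0r -sgrEz -(fc _ _ ij) mulrC mulr_sg_norm.
Qed.

Lemma inner_ge0 {R : realType} {k : nat} (x : 'cV[R]_k) : 0 <= inner x x.
Proof. by rewrite -enorm_sqr sqr_ge0. Qed.

Lemma inner_eq0 {R : realType} {k : nat} (x : 'cV[R]_k) :
  (inner x x == 0) = (x == 0).
Proof.
apply/idP/eqP => [|->]; last by rewrite /inner big1// => i _; rewrite mxE mul0r.
rewrite psumr_eq0 => [/allP x0|i _]; last by rewrite -expr2 sqr_ge0.
apply/matrixP => i j; rewrite (ord1 j) mxE.
by have := x0 i (mem_index_enum i); rewrite mulf_eq0 orbb => /eqP.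
Qed.

Lemma inner_le_coord {R : realType} {k : nat} (x : 'cV[R]_k) (e : R) :
  (forall i, `|x i 0| <= e) -> inner x x <= k%:R * e ^+ 2.
Proof.
move=> xe; rewrite mulr_natl -[k in _ *+ k]card_ord -sumr_const.
apply: ler_sum => i _; rewrite -expr2 -real_normK ?num_real//.
by rewrite lerXn2r// nnegrE// (le_trans _ (xe i)).
Qed.

(** [alpha] times the Gram matrix is the integer matrix [alpha + S]. *)
Lemma norm_form_int {R : realType} {n k : nat} {f : 'I_n -> 'cV[R]_k}
    {c alpha : R} (a : 'cV[int]_n) :
  is_unit_etf f c -> c = 1 / alpha -> alpha \is a Num.int ->
  alpha * norm_form f (int_vec R a) \is a Num.int.
Proof.
move=> hf hc /intrP[m am].
have alpha0 : alpha != 0.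
  case: hf => /andP[c0 _] _ _ _; apply: contraTneq c0 => a0.
  by rewrite hc a0 invr0 mulr0 ltxx.
have E : alpha *: ((frame_mx f)^T *m frame_mx f) =
    map_mx intr (m%:M + seidel f).
  rewrite (gram_seidel hf) hc scalerDr scalerA mul1r divff// scale1r.
  by rewrite scalemx1 map_mxD map_scalar_mx am.
apply/intrP; exists ((a^T *m (m%:M + seidel f) *m a) 0 0).
have -> : alpha * norm_form f (int_vec R a) =
    ((int_vec R a)^T *m (alpha *: ((frame_mx f)^T *m frame_mx f))
      *m int_vec R a) 0 0.
  rewrite /norm_form enorm_sqr inner_mx trmx_mul -scalemxAr -scalemxAl [RHS]mxE.
  by rewrite !mulmxA.
by rewrite E /int_vec map_trmx -!map_mxM mxE.
Qed.

(** * Discreteness of the integral span *)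

Lemma int_span_closed {R : realType} {n k : nat} (f : 'I_n -> 'cV[R]_k) :
  zmod_closed (mem (int_span f)).
Proof.
split=> [|x y]; rewrite !inE.
  by exists 0 => //; rewrite /int_vec map_mx0 mulmx0.
by move=> [a _ <-] [b _ <-]; exists (a - b) => //; rewrite int_vecB mulmxBr.
Qed.

(** The integral span is a group, so isolating [0] from its other elements
    isolates every point from the others. *)
Lemma lattice_of_norm_ge {R : realType} {n k : nat} {f : 'I_n -> 'cV[R]_k}
    {d : R} : 0 < d ->
  (forall a : 'cV[int]_n, frame_mx f *m int_vec R a != 0 ->
     d <= norm_form f (int_vec R a)) ->
  is_lattice (int_span f).
Proof.
move=> d0 fd; split; first exact: int_span_closed.
move=> x fx; split; first by rewrite inE.
(* A vector with coordinates at most [e] has squared norm at most [k e ^ 2],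
   which is below [d]; [k.+1] rather than [k] makes this strict and also
   covers [k = 0]. *)
pose e := Num.sqrt (d / k.+1%:R).
have e0 : 0 < e by rewrite sqrtr_gt0 divr_gt0.
exists (ball x e); first exact: nbhsx_ballx.
apply/seteqP; split=> [y [xy fy]|_ ->]; last by split => //; exact: ballxx.
apply/eqP; rewrite eq_sym -subr_eq0.
have : x - y \in int_span f.
  by apply: (int_span_closed f).2; rewrite inE.
rewrite inE => -[a _ aE]; rewrite -aE; apply: contraT => /fd.
rewrite /norm_form aE enorm_sqr leNgt => /negP[].
apply: (@le_lt_trans _ _ (k%:R * e ^+ 2)).
  apply: inner_le_coord => i; have := xy.2 i 0; rewrite /ball/= => /ltW.
  by rewrite !mxE.
rewrite sqr_sqrtr ?divr_ge0 ?(ltW d0)// mulrCA gtr_pMr//.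
by rewrite ltr_pdivrMr// mul1r ltr_nat.
Qed.

(** An integral combination that is small enough lies in a neighbourhood of
    [0] which contains no other element of the lattice. *)
Lemma lattice_relation {R : realType} {n k : nat} {f : 'I_n -> 'cV[R]_k} :
  (k < n)%N -> is_lattice (int_span f) ->
  exists2 a : 'cV[int]_n, a != 0 & frame_mx f *m int_vec R a = 0.
Proof.
move=> kn [[/set_mem L0 _] Ld].
have [_ [V /nbhs_ballP[e/= e0 eV] VL]] := Ld _ L0.
have [a a0 ae] := small_integer_combination (frame_mx f) kn e0.
exists a => //; have : (V `&` int_span f) (frame_mx f *m int_vec R a).
  split; last by exists a.
  apply: eV; split=> // i j; rewrite (ord1 j) /ball/= mxE sub0r normrN; exact: ae.
by rewrite VL.
Qed.

(** * The angle of the frame *)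

(** An integral relation [G a = 0] gives [(1 + c S) a = G^T (G a) = 0], so [a]
    is an integral eigenvector of [- S] for the eigenvalue [1 / c = alpha]. *)
Lemma etf_alpha_int {R : realType} {n k : nat} {f : 'I_n -> 'cV[R]_k}
    {c alpha : R} :
  is_unit_etf f c -> c = 1 / alpha -> is_lattice (int_span f) ->
  exists2 m : nat, (0 < m)%N & alpha = m%:R.
Proof.
move=> hf hc hL; have [/andP[c0 _] [kn _ _] _ _] := hf.
have alpha0 : 0 < alpha by move: c0; rewrite hc div1r invr_gt0.
have [a a0 Ga] := lattice_relation kn hL.
suff : alpha \is a Num.nat.
  move=> /natrP[m am]; exists m => //.
  by rewrite -(ltr_nat R) -am.
rewrite natrEint (ltW alpha0) andbT.
apply: (int_eigenvector_int (- seidel f) a0).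
have : ((frame_mx f)^T *m frame_mx f) *m int_vec R a = 0.
  by rewrite -mulmxA Ga mulmx0.
rewrite (gram_seidel hf) mulmxDl mul1mx -scalemxAl => /eqP.
rewrite addr_eq0 => /eqP aE; rewrite [in RHS]aE.
by rewrite hc div1r map_mxN mulNmx scalerN scalerA divff ?gt_eqF// scale1r.
Qed.

(** [alpha ||G a||^2] is a positive integer, hence at least 1. *)
Lemma etf_norm_form_ge {R : realType} {n k : nat} {f : 'I_n -> 'cV[R]_k}
    {c alpha : R} (a : 'cV[int]_n) :
  is_unit_etf f c -> c = 1 / alpha -> 0 < alpha -> alpha \is a Num.int ->
  frame_mx f *m int_vec R a != 0 ->
  alpha^-1 <= norm_form f (int_vec R a).
Proof.
move=> hf hc a0 aint Ga.
have Q0 : 0 < norm_form f (int_vec R a).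
  by rewrite /norm_form enorm_sqr lt0r inner_ge0 inner_eq0 Ga.
have := norm_intr_ge1 (norm_form_int a hf hc aint).
rewrite mulf_neq0 ?gt_eqF// => /(_ isT).
by rewrite (gtr0_norm (mulr_gt0 a0 Q0)) -ler_pdivrMl// mulr1.
Qed.

(** The minimum exists because the squared norms, multiplied by [alpha], are
    natural numbers, and because the span has a nonzero vector: any [f i], which
    has norm 1. *)
Lemma etf_minimal_norm {R : realType} {n k : nat} {f : 'I_n -> 'cV[R]_k}
    {c alpha : R} :
  is_unit_etf f c -> c = 1 / alpha -> 0 < alpha -> alpha \is a Num.int ->
  exists2 r : R, is_minimal_norm (int_span f) r & 1 / Num.sqrt alpha <= r.
Proof.
move=> hf hc a0 aint; have [_ [kn _ _] f1 _] := hf.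
pose P N := `[< exists2 a : 'cV[int]_n, frame_mx f *m int_vec R a != 0 &
  alpha * norm_form f (int_vec R a) = N%:R >].
have Pnat (a : 'cV[int]_n) : exists N, alpha * norm_form f (int_vec R a) = N%:R.
  apply/natrP; rewrite natrEint (norm_form_int a hf hc aint)/=.
  by rewrite mulr_ge0 ?(ltW a0)// sqr_ge0.
have exP : exists N, P N.
  have i0 : 'I_n by case: n kn {f hf hc f1 P Pnat} => // n _; exact: ord0.
  pose a : 'cV[int]_n := delta_mx i0 0.
  have [N aN] := Pnat a; exists N; apply/asboolP; exists a => //.
  rewrite /int_vec map_delta_mx -colE -inner_eq0.
  have -> : col i0 (frame_mx f) = f i0.
    by apply/matrixP => i j; rewrite !mxE (ord1 j).
  by rewrite -enorm_sqr f1 expr1n oner_eq0.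
case: (ex_minnP exP) => N /asboolP[a Ga aN] Nmin.
exists (enorm (frame_mx f *m int_vec R a)); first split.
- exists (frame_mx f *m int_vec R a) => //; split; first by exists a.
  exact/eqP.
- move=> _ [_ [[b _ <-] /eqP Gb] <-].
  have [M bM] := Pnat b.
  have NM : (N <= M)%N by apply: Nmin; apply/asboolP; exists b.
  rewrite -(@ler_pXn2r _ 2)// ?nnegrE ?sqrtr_ge0// -(ler_pM2l a0).
  by rewrite -/(norm_form _ _) aN bM ler_nat.
- rewrite div1r -sqrtrV ?(ltW a0)// ler_wsqrtr//.
  by rewrite -enorm_sqr; exact: etf_norm_form_ge hf hc a0 aint Ga.
Qed.

Lemma etf_separated {R : realType} {n k : nat} {f : 'I_n -> 'cV[R]_k}
    {c alpha : R} :
  is_unit_etf f c -> c = 1 / alpha -> 0 < alpha -> alpha \is a Num.int ->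
  separated_values (norm_form f).
Proof.
move=> hf hc a0 aint; rewrite /separated_values.
apply: (@lt_le_trans _ _ (alpha^-1)%:E); first by rewrite lte_fin invr_gt0.
apply: le_ereal_inf_tmp => _ [a [b [ab ->]]]; rewrite lee_fin.
rewrite -[leLHS]mulr1 ler_pdivrMl// -[X in X * _](gtr0_norm a0) -normrM mulrBr.
apply: norm_intr_ge1; first by rewrite rpredB//; exact: norm_form_int hf hc aint.
by rewrite subr_eq0 (inj_eq (mulfI _)) // gt_eqF.
Qed.

(** The value at [0] is 0, so separation of values bounds all nonzero values
    from below. *)
Lemma separated_norm_ge {R : realType} {n k : nat} {f : 'I_n -> 'cV[R]_k} :
  separated_values (norm_form f) ->
  exists2 d : R, 0 < d & forall a : 'cV[int]_n,
    frame_mx f *m int_vec R a != 0 -> d <= norm_form f (int_vec R a).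
Proof.
rewrite /separated_values; set S := [set r | _]; move=> S0.
have Qin (a : 'cV[int]_n) : frame_mx f *m int_vec R a != 0 ->
    S (norm_form f (int_vec R a))%:E.
  move=> Ga; exists a, 0.
  have -> : norm_form f (int_vec R 0) = 0.
    rewrite /norm_form enorm_sqr /int_vec map_mx0 mulmx0.
    by apply/eqP; rewrite inner_eq0.
  by rewrite subr0 ger0_norm ?sqr_ge0// /norm_form enorm_sqr inner_eq0.
case E : (ereal_inf S) S0 => [d| |]//.
- rewrite lte_fin => d0; exists d => // a /Qin /ereal_inf_lbound.
  by rewrite E lee_fin.
(* The infimum is infinite only if [S] is empty, and then no combination is
   nonzero, so that any bound will do. *)
- by move=> _; exists 1 => // a /Qin /ereal_inf_lbound; rewrite E.
Qed.

Theorem theorem3 (R : realType) (n k : nat) (f : 'I_n -> 'cV[R]_k)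
    (c alpha : R) (hf : is_unit_etf f c) (hc : c = 1 / alpha) :
  [<-> (exists2 m : nat, (0 < m)%N & alpha = m%:R);
       is_lattice (int_span f);
       separated_values (norm_form f)]
  /\ ((exists2 m : nat, (0 < m)%N & alpha = m%:R) ->
      exists2 r : R, is_minimal_norm (int_span f) r & 1 / Num.sqrt alpha <= r).
Proof.
have pos_int : (exists2 m : nat, (0 < m)%N & alpha = m%:R) ->
    0 < alpha /\ alpha \is a Num.int.
  by move=> [m m0 ->]; rewrite ltr0n m0 intr_nat ?natr_nat.
split; last by move=> /pos_int[]; exact: etf_minimal_norm hf hc.
tfae.
- move=> /pos_int[a0 aint].
  apply: (@lattice_of_norm_ge _ _ _ _ alpha^-1); first by rewrite invr_gt0.
  by move=> a; exact: etf_norm_form_ge hf hc a0 aint.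
- move=> /(etf_alpha_int hf hc) /pos_int[]; exact: etf_separated hf hc.
- move=> /separated_norm_ge[d d0 fd].
  exact: etf_alpha_int hf hc (lattice_of_norm_ge d0 fd).
Qed.
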